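(* Let $k\ge1$. Every levelset winning subset of $\mathbb R^k$ is hyperplane winning.
   Context: For $\beta>0$, the $\beta$-hyperplane game on $\mathbb R^k$: Bob chooses a ball $B_0=B(\mathbf x_0,\rho_0)$; after Bob's move $B_n=B(\mathbf x_n,\rho_n)$, Alice chooses an affine hyperplane $A_n$; then Bob must choose $B_{n+1}=B(\mathbf x_{n+1},\rho_{n+1})$ with $B_{n+1}\subset B_n\setminus A_n^{(\beta\rho_n)}$ and $\rho_{n+1}\ge\beta\rho_n$ ($S^{(\epsilon)}$ the $\epsilon$-neighbourhood of $S$); if he cannot, he loses. $S$ is $\beta$-hyperplane winning if Alice has a strategy guaranteeing that Bob loses or $\bigcap_nB_n\cap S\ne\emptyset$; $S$ is hyperplane winning if it is $\beta$-hyperplane winning for every $\beta>0$. For a ball $B$ and a $C^D$ function $f:B\to\mathbb R$, $\|f\|_{C^D,\mathbf x}=\max_{\alpha\in\mathbb N^k,|\alpha|\le D}|f^{(\alpha)}(\mathbf x)|$ and $\|f\|_{C^D,B}=\sup_{\mathbf x\in B}\|f\|_{C^D,\mathbf x}$. The $(\beta,D,C_1)$-levelset game has the same rules as the $\beta$-hyperplane game except that Alice's $A_n$ is the zero set of any $C^{D+1}$ function $f:B_n\to\mathbb R$, not identically zero, with $\|f\|_{C^{D+1},B_n}\le C_1\|f\|_{C^D,B_n}$. A set is levelset winning if there exist $D\in\mathbb N$ and $C_1>0$ such that it is $(\beta,D,C_1)$-levelset winning for all $\beta>0$. *)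

(* Defs.v *)
From mathcomp Require Import all_boot all_order all_algebra.
From mathcomp Require Import all_classical all_reals all_analysis.

Set Implicit Arguments.
Unset Strict Implicit.
Unset Printing Implicit Defensive.

Import Order.TTheory GRing.Theory Num.Theory.
Import numFieldNormedType.Exports.

Local Open Scope classical_set_scope.
Local Open Scope ring_scope.

(* R^k is 'rV[R]_k.  The library norm on 'rV[R]_k is the sup norm (it induces
   the same topology), so the Euclidean distance is defined here. *)
Definition edist (R : realType) (k : nat) (x y : 'rV[R]_k) : R :=
  Num.sqrt (\sum_(i < k) (x 0 i - y 0 i) ^+ 2).

(* A pair (x, rho) stands for the closed Euclidean ball B(x, rho). *)
Definition eball (R : realType) (k : nat) (B : 'rV[R]_k * R) : set 'rV[R]_k :=
  [set y | edist B.1 y <= B.2].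

Definition thickening (R : realType) (k : nat) (A : set 'rV[R]_k) (e : R) :
    set 'rV[R]_k :=
  [set x | exists2 y, A y & edist x y < e].

Definition bob_legal (R : realType) (k : nat) (beta : R)
    (B : 'rV[R]_k * R) (A : set 'rV[R]_k) (B' : 'rV[R]_k * R) : Prop :=
  eball B' `<=` eball B `\` thickening A (beta * B.2) /\ beta * B.2 <= B'.2.

(* A strategy sends the history [:: B_0; ...; B_n] to Alice's answer A_n.
   legal B A says that A is an admissible answer to the ball B; a strategy must
   answer legally at every position it can reach.  A play in which Bob gets
   stuck is finite and lost by Bob, so only infinite plays are constrained by
   the target set S. *)
Definition winning (R : realType) (k : nat) (beta : R)
    (legal : 'rV[R]_k * R -> set 'rV[R]_k -> Prop) (S : set 'rV[R]_k) : Prop :=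
  exists sigma : seq ('rV[R]_k * R) -> set 'rV[R]_k,
  forall b : nat -> 'rV[R]_k * R,
    let A n := sigma (mkseq b n.+1) in
    0 < (b 0%N).2 ->
    (forall n,
       (forall m, (m < n)%N -> bob_legal beta (b m) (A m) (b m.+1)) ->
       legal (b n) (A n))
    /\ ((forall n, bob_legal beta (b n) (A n) (b n.+1)) ->
        (\bigcap_n eball (b n)) `&` S !=set0).

Definition affine_hyperplane (R : realType) (k : nat) (A : set 'rV[R]_k) :
    Prop :=
  exists (a : 'rV[R]_k) (c : R),
    a != 0 /\ A = [set x | \sum_(i < k) a 0 i * x 0 i = c].

Definition hyperplane_winning (R : realType) (k : nat) (S : set 'rV[R]_k) :
    Prop :=
  forall beta : R, 0 < beta ->
    winning beta (fun _ A => affine_hyperplane A) S.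

Definition partial (R : realType) (k : nat) (i : 'I_k) (f : 'rV[R]_k -> R) :
    'rV[R]_k -> R :=
  fun x => 'D_(delta_mx 0 i) f x.

(* f is of class C^n on the open set U. *)
Fixpoint Cn_on (R : realType) (k : nat) (n : nat) (U : set 'rV[R]_k)
    (f : 'rV[R]_k -> R) : Prop :=
  (forall x, U x -> {for x, continuous f}) /\
  match n with
  | 0%N => True
  | n'.+1 => forall i : 'I_k,
      (forall x, U x -> derivable f x (delta_mx 0 i)) /\
      Cn_on n' U (partial i f)
  end.

(* A C^n function on a closed ball is the restriction of a function that is
   C^n on an open neighbourhood of it. *)
Definition Cn_near (R : realType) (k : nat) (n : nat) (K : set 'rV[R]_k)
    (f : 'rV[R]_k -> R) : Prop :=
  exists U : set 'rV[R]_k, [/\ open U, K `<=` U & Cn_on n U f].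

Definition mpartial (R : realType) (k : nat) (alpha : 'I_k -> nat)
    (f : 'rV[R]_k -> R) : 'rV[R]_k -> R :=
  foldr (fun i g => iter (alpha i) (partial i) g) f (enum 'I_k).

(* Multi-indices of order at most D have all their entries at most D. *)
Definition Cnorm_at (R : realType) (k D : nat) (f : 'rV[R]_k -> R)
    (x : 'rV[R]_k) : R :=
  \big[Num.max/0]_(alpha : {ffun 'I_k -> 'I_D.+1}
                     | (\sum_(i < k) alpha i <= D)%N)
     `|mpartial (fun i => nat_of_ord (alpha i)) f x|.

Definition Cnorm (R : realType) (k D : nat) (K : set 'rV[R]_k)
    (f : 'rV[R]_k -> R) : R :=
  sup [set Cnorm_at D f x | x in K].

Definition levelset_legal (R : realType) (k D : nat) (C1 : R)
    (B : 'rV[R]_k * R) (A : set 'rV[R]_k) : Prop :=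
  exists f : 'rV[R]_k -> R,
    [/\ Cn_near D.+1 (eball B) f,
        exists2 x, eball B x & f x != 0,
        Cnorm D.+1 (eball B) f <= C1 * Cnorm D (eball B) f &
        A = [set x | eball B x /\ f x = 0]].

Definition levelset_winning (R : realType) (k : nat) (S : set 'rV[R]_k) :
    Prop :=
  exists (D : nat) (C1 : R),
    0 < C1 /\
    forall beta : R, 0 < beta -> winning beta (levelset_legal D C1) S.

(* Main.v *)
Require Import Defs.
From mathcomp Require Import all_boot all_order all_algebra.
From mathcomp Require Import all_classical all_reals all_analysis.
From mathcomp Require Import ring lra zify.

(* Alice simulates a (beta', D, C1)-levelset game, with beta' much smaller than
   beta, inside the beta-hyperplane game.  Let the levelset strategy answer a
   ball B of small radius rho with the zero set of f.  Weight the derivatives of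
   order j by rho ^ j.  Since the derivatives of order D.+1 are controlled by
   those of order at most D, after shrinking B by a constant factor some weighted
   derivative of order at most D is comparable on the whole ball to the maximum N
   of all of them.  Lower its order step by step: if a partial derivative of g is
   bounded below on a ball, then the zero set of g is close to the tangent
   hyperplane {g(x) + dg(x)(y - x) = 0} at the center x once the ball is small,
   and Bob's next ball, which avoids a neighbourhood of that hyperplane, has g
   bounded below.  After at most D steps f itself is at least c' N in absolute
   value, hence Bob's ball is at distance at least beta' rho from the zeros of f,
   and it is a legal move of the levelset game.  Hyperplanes through the center
   halve the radius, so Alice can shrink the balls at will. *)

Set Implicit Arguments.
Unset Strict Implicit.
Unset Printing Implicit Defensive.

Import Order.TTheory GRing.Theory Num.Theory.
Import numFieldNormedType.Exports.
(* MathComp-Analysis also has an [edist]; this gives priority to ours. *)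
Import Defs.

Local Open Scope classical_set_scope.
Local Open Scope ring_scope.

(** * Euclidean balls and the mean value inequality *)

Section Euclid.
Variables (R : realType) (k : nat).
Implicit Types (x y z u : 'rV[R]_k) (i : 'I_k).

Lemma edistxx x : edist x x = 0.
Proof. by rewrite /edist big1 ?sqrtr0// => i _; rewrite subrr expr0n. Qed.

Lemma edist_le_coord x y x' y' :
  (forall i, `|x 0 i - y 0 i| <= `|x' 0 i - y' 0 i|) ->
  edist x y <= edist x' y'.
Proof.
move=> h; apply: ler_wsqrtr; apply: ler_sum => i _.
by rewrite -[leLHS]real_normK ?num_real// -[leRHS]real_normK ?num_real// lerXn2r ?nnegrE.
Qed.

Lemma coord_le_edist x y i : `|x 0 i - y 0 i| <= edist x y.
Proof.
rewrite -sqrtr_sqr; apply: ler_wsqrtr.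
by rewrite (bigD1 i)//= lerDl sumr_ge0// => j _; exact: sqr_ge0.
Qed.

Lemma sum_coord_le_edist x y :
  \sum_(i < k) `|x 0 i - y 0 i| <= k%:R * edist x y.
Proof.
rewrite mulr_natl -[X in _ *+ X](card_ord k) -sumr_const.
by apply: ler_sum => i _; exact: coord_le_edist.
Qed.

Lemma edistD x a t : edist x (x + t *: a) = `|t| * edist 0 a.
Proof.
rewrite /edist -sqrtr_sqr -sqrtrM ?sqr_ge0// mulr_sumr.
by congr Num.sqrt; apply: eq_bigr => i _; rewrite !mxE; ring.
Qed.

Lemma edist_delta i : edist 0 (delta_mx 0 i : 'rV[R]_k) = 1.
Proof.
rewrite /edist (bigD1 i)//= big1 => [|j ji]; rewrite !mxE eqxx.
  by rewrite eqxx sub0r sqrrN expr1n addr0 sqrtr1.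
by rewrite (negbTE ji) subrr expr0n.
Qed.

Lemma eball_center x r : 0 <= r -> eball (x, r) x.
Proof. by rewrite /eball /= edistxx. Qed.

Lemma eball_delta (B : 'rV[R]_k * R) i t :
  `|t| <= B.2 -> eball B (B.1 + t *: delta_mx 0 i).
Proof. by rewrite /eball /= edistD edist_delta mulr1. Qed.

(** The ends of a diameter of [B'] parallel to a coordinate axis both lie in [B], and in [B] that
    coordinate stays within [B.2] of the center. *)
Lemma eball_sub_radius (B B' : 'rV[R]_k * R) : (0 < k)%N -> 0 <= B'.2 ->
  eball B' `<=` eball B -> B'.2 <= B.2.
Proof.
move=> k0 r0 sub; pose i := Ordinal k0.
have h t : `|t| <= B'.2 -> `|B'.1 0 i + t - B.1 0 i| <= B.2.
  move=> /(eball_delta i)/sub; apply: le_trans.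
  rewrite distrC (le_trans _ (coord_le_edist _ _ i))//.
  by rewrite !mxE !eqxx mulr1.
have := h B'.2; have := h (- B'.2); rewrite normrN ger0_norm// lexx.
move=> /(_ isT)+ /(_ isT); rewrite !ler_norml => /andP[h1 h2] /andP[h3 h4]; lra.
Qed.

Lemma sum_coord_le_eball (B : 'rV[R]_k * R) y z : eball B y -> eball B z ->
  \sum_(i < k) `|y 0 i - z 0 i| <= 2 * k%:R * B.2.
Proof.
move=> By Bz.
apply: (@le_trans _ _ (\sum_(i < k) (`|B.1 0 i - y 0 i| + `|B.1 0 i - z 0 i|))).
  apply: ler_sum => i _; rewrite distrC.
  have -> : z 0 i - y 0 i = (B.1 0 i - y 0 i) - (B.1 0 i - z 0 i) by ring.
  exact: ler_normB.
rewrite big_split/=.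
have := ler_wpM2l (ler0n R k) By; have := ler_wpM2l (ler0n R k) Bz.
by have := sum_coord_le_edist B.1 y; have := sum_coord_le_edist B.1 z; lra.
Qed.

End Euclid.

(** The point [p + s] lies between [p] and [q], and the distance to [c] is convex, so it is largest
    at an endpoint. In [mvt_eball] this keeps a segment parallel to an axis inside the ball. *)
Lemma dist_toward (R : realDomainType) (c p q s : R) :
  `|c - q| <= `|c - p| -> `|s| <= `|q - p| -> 0 <= s * (q - p) ->
  `|c - (p + s)| <= `|c - p|.
Proof.
move=> h1 h2 h3.
have hs : (0 <= s /\ s <= q - p) \/ (s <= 0 /\ q - p <= s).
  move: h2 h3; case: (ltgtP (q - p) 0) => [qp|qp|->].
  - rewrite nmulr_lge0// (ltr0_norm qp) => + s0.
    by rewrite ler0_norm//; right; split; lra.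
  - rewrite pmulr_lge0// (gtr0_norm qp) => + s0.
    by rewrite ger0_norm//; left; split; lra.
  - by rewrite normr0 normr_le0 => /eqP -> _; left; lra.
move: h1; case: (ger0P (c - q)) => ?; case: (ger0P (c - p)) => ?;
  case: (ger0P (c - (p + s))) => ? ?; case: hs => -[? ?]; lra.
Qed.

Section MeanValue.
Variables (R : realType) (k : nat).
Implicit Types (x y z u : 'rV[R]_k) (i : 'I_k) (g : 'rV[R]_k -> R).

Lemma is_derive_line g y i t :
  derivable g (y + t *: delta_mx 0 i) (delta_mx 0 i) ->
  is_derive t 1 (fun s => g (y + s *: delta_mx 0 i))
    (partial i g (y + t *: delta_mx 0 i)).
Proof.
set e := delta_mx 0 i => dg.
have E : (fun h : R => h^-1 *: (((fun s => g (y + s *: e)) \o shift t) (h *: 1) -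
           g (y + t *: e))) =
         (fun h : R => h^-1 *: ((g \o shift (y + t *: e)) (h *: e) - g (y + t *: e))).
  apply/funext => h /=; congr (_ *: (g _ - _)).
  by rewrite [_%:A]mulr1 scalerDl addrCA.
by apply: DeriveDef; rewrite ?/partial /derivable /derive E.
Qed.

(** Together, [|s| <= |t|] and [0 <= s * t] say that [s] lies between 0 and [t], for either sign of
    [t]; derivability is thus required on the segment only. *)
Lemma mvt_line g y i (t : R) :
  (forall s, `|s| <= `|t| -> 0 <= s * t ->
     derivable g (y + s *: delta_mx 0 i) (delta_mx 0 i)) ->
  exists s, [/\ `|s| <= `|t|, 0 <= s * t &
    g (y + t *: delta_mx 0 i) - g y = partial i g (y + s *: delta_mx 0 i) * t].
Proof.
move=> dg; pose phi s := g (y + s *: delta_mx 0 i).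
pose dphi s := partial i g (y + s *: delta_mx 0 i).
have phi0 : phi 0 = g y by rewrite /phi scale0r addr0.
have D (s : R) : `|s| <= `|t| -> 0 <= s * t -> is_derive s 1 phi (dphi s).
  by move=> st s0; apply: is_derive_line; exact: dg.
have C (a b : R) : (forall s : R, s \in `[a, b] -> is_derive s 1 phi (dphi s)) ->
    {within `[a, b], continuous phi}.
  move=> H; apply: continuous_in_subspaceT => s /set_mem/H[] ds _.
  by apply/differentiable_continuous/derivable1_diffP.
have [t0|t0] := leP 0 t.
  have H (s : R) : s \in `[0, t] -> `|s| <= `|t| /\ 0 <= s * t.
    by rewrite in_itv/= => /andP[s0 st]; rewrite !ger0_norm// mulr_ge0.
  have [||s si] := @MVT_segment _ phi dphi 0 t t0.
  - by move=> s /subset_itv_oo_cc/H[] ? ?; exact: D.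
  - by apply: C => s /H[]; exact: D.
  by rewrite phi0 subr0 => E; exists s; have [? ?] := H _ si.
have H (s : R) : s \in `[t, 0] -> `|s| <= `|t| /\ 0 <= s * t.
  rewrite in_itv/= => /andP[st s0]; rewrite !ler0_norm ?(ltW t0)//.
  by rewrite lerN2; split => //; rewrite mulr_le0// ltW.
have [||s si] := @MVT_segment _ phi dphi t 0 (ltW t0).
- by move=> s /subset_itv_oo_cc/H[] ? ?; exact: D.
- by apply: C => s /H[]; exact: D.
rewrite phi0 => E; exists s; have [? ?] := H _ si; split => //.
by apply: oppr_inj; rewrite opprB E sub0r mulrN.
Qed.

(* The coordinates are changed one at a time.  To stay inside the ball, the
   coordinate that is farther from the center is replaced by the nearer one,
   whichever of the two endpoints it belongs to. *)
Lemma mvt_eball (B : 'rV[R]_k * R) g (a : 'I_k -> R) (L : R) :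
  (forall u i, eball B u -> derivable g u (delta_mx 0 i)) ->
  (forall u i, eball B u -> `|partial i g u - a i| <= L) ->
  forall y z, eball B y -> eball B z ->
  `|g y - g z - \sum_(i < k) a i * (y 0 i - z 0 i)|
     <= L * \sum_(i < k) `|y 0 i - z 0 i|.
Proof.
move=> dg La y z; move n_def : #|[pred i | y 0 i != z 0 i]| => n.
elim: n y z n_def => [|n IH] y z n_def By Bz.
  have -> : y = z.
    apply/rowP => i; apply: contra_eq n_def => yzi.
    by rewrite (cardD1 i) inE yzi.
  rewrite subrr sub0r !big1 ?oppr0 ?normr0 ?mulr0// => i _.
    by rewrite subrr normr0.
  by rewrite subrr mulr0.
wlog : y z n_def By Bz / exists2 i, y 0 i != z 0 i &
    `|B.1 0 i - z 0 i| <= `|B.1 0 i - y 0 i|.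
  move=> W; have [i] : exists i, i \in [pred i | y 0 i != z 0 i].
    by apply/card_gt0P; rewrite n_def.
  rewrite inE => yzi.
  have [zy|/ltW yz] := leP `|B.1 0 i - z 0 i| `|B.1 0 i - y 0 i|.
    by apply: W => //; exists i.
  have := W z y _ Bz By; rewrite -normrN.
  have -> : - (g z - g y - \sum_(j < k) a j * (z 0 j - y 0 j)) =
            g y - g z - \sum_(j < k) a j * (y 0 j - z 0 j).
    have -> : \sum_(j < k) a j * (z 0 j - y 0 j) = - \sum_(j < k) a j * (y 0 j - z 0 j).
      by rewrite -sumrN; apply: eq_bigr => j _; ring.
    by ring.
  have -> : \sum_(j < k) `|z 0 j - y 0 j| = \sum_(j < k) `|y 0 j - z 0 j|.
    by apply: eq_bigr => j _; rewrite distrC.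
  apply; last by exists i; rewrite // eq_sym.
  by rewrite -n_def; apply: eq_card => j; rewrite !inE eq_sym.
case=> i yzi nearer; pose t := z 0 i - y 0 i; pose y' := y + t *: delta_mx 0 i.
have y'E j : y' 0 j = if j == i then z 0 i else y 0 j.
  by rewrite !mxE eqxx/=; case: eqP => [->|_]; rewrite /t /=; ring.
have Bs (s : R) : `|s| <= `|t| -> 0 <= s * t -> eball B (y + s *: delta_mx 0 i).
  move=> st s0; apply: le_trans By; apply: edist_le_coord => j.
  rewrite !mxE eqxx/= ; have [->|ji] := eqVneq j i; last first.
    by rewrite mulr0 addr0.
  by rewrite mulr1; apply: (dist_toward nearer).
have By' : eball B y' by apply: Bs => //; exact: sqr_ge0.
have [s [st s0 E]] := @mvt_line g y i t (fun s st s0 => dg _ _ (Bs s st s0)).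
have := La _ i (Bs s st s0); set p := partial i g _ in E * => Lp.
have card' : #|[pred j | y' 0 j != z 0 j]| = n.
  move: n_def; rewrite (cardD1 i) inE yzi => -[<-]; apply: eq_card => j.
  by rewrite !inE y'E; case: (eqVneq j i) => [->|]; rewrite ?eqxx.
have := IH _ _ card' By' Bz.
have sumE (F G : 'I_k -> R) : G i = 0 -> (forall j, j != i -> F j = G j) ->
    \sum_(j < k) F j = F i + \sum_(j < k) G j.
  move=> Gi FG; rewrite (bigD1 i)//= [X in _ = _ + X](bigD1 i)//= Gi add0r.
  by congr (_ + _); exact: eq_bigr.
have y'zi : y' 0 i - z 0 i = 0 by rewrite y'E eqxx subrr.
rewrite (sumE (fun j => a j * (y 0 j - z 0 j)) (fun j => a j * (y' 0 j - z 0 j))).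
- rewrite (sumE (fun j => `|y 0 j - z 0 j|) (fun j => `|y' 0 j - z 0 j|)).
  + set sa := \sum_(_ < k) _; set sl := \sum_(_ < k) _ => IHn.
    have -> : g y - g z - (a i * (y 0 i - z 0 i) + sa) =
        (p - a i) * (y 0 i - z 0 i) + (g y' - g z - sa).
      have -> : g y = g y' - p * t by rewrite -E; ring.
      by rewrite /t; ring.
    rewrite [leRHS]mulrDr; apply: le_trans (ler_normD _ _) (lerD _ IHn).
    by rewrite normrM ler_wpM2r.
  + by rewrite y'zi normr0.
  + by move=> j /negbTE ji; rewrite y'E ji.
- by rewrite y'zi mulr0.
- by move=> j /negbTE ji; rewrite y'E ji.
Qed.

End MeanValue.

(** * Symmetry of mixed partial derivatives *)

Section Clairaut.
Variables (R : realType) (k : nat).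
Implicit Types (x y z u : 'rV[R]_k) (i j : 'I_k) (f g : 'rV[R]_k -> R).
Implicit Types (U : set 'rV[R]_k).

Lemma derivable_shift f c y v :
  derivable f (y + c) v -> derivable (fun y => f (y + c)) y v.
Proof.
rewrite /derivable; set F := (X in cvg (X @ _)); set G := (X in _ -> cvg (X @ _)).
suff -> : F = G by [].
by apply/funext => h; rewrite /F /G /= addrA.
Qed.

Lemma partial_shift f c y i :
  partial i (fun y => f (y + c)) y = partial i f (y + c).
Proof.
rewrite /partial /derive; set F := (X in lim (X @ _) = _).
set G := (X in _ = lim (X @ _)).
by have -> : F = G by apply/funext => h; rewrite /F /G /= addrA.
Qed.

(** The mean value theorem is applied in direction [i] to the increment [g] of [f] in direction [j],
    then in direction [j] to [partial i f]. The left side is symmetric in [i] and [j]. *)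
Lemma second_difference f x i j (h : R) : 0 <= h ->
  (forall s t : R, `|s| <= h -> `|t| <= h ->
    let p := x + s *: delta_mx 0 i + t *: delta_mx 0 j in
    derivable f p (delta_mx 0 i) /\ derivable (partial i f) p (delta_mx 0 j)) ->
  exists s t : R, [/\ `|s| <= h, `|t| <= h &
    f (x + h *: delta_mx 0 i + h *: delta_mx 0 j) - f (x + h *: delta_mx 0 i)
      - (f (x + h *: delta_mx 0 j) - f x)
    = partial j (partial i f) (x + s *: delta_mx 0 i + t *: delta_mx 0 j)
      * h * h].
Proof.
move=> h0 df; pose g y := f (y + h *: delta_mx 0 j) - f y.
have nh : `|h| = h by rewrite ger0_norm.
have dfx s : `|s| <= h -> derivable f (x + s *: delta_mx 0 i) (delta_mx 0 i).
  move=> sh; have h00 : `|0 : R| <= h by rewrite normr0.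
  by have [+ _] := df s 0 sh h00; rewrite scale0r (addr0 (x + _)).
have dfh s : `|s| <= h ->
    derivable (fun y => f (y + h *: delta_mx 0 j)) (x + s *: delta_mx 0 i) (delta_mx 0 i).
  by move=> sh; apply: derivable_shift; apply: (df s h sh _).1; rewrite nh.
have [s [sh _ Es]] : exists s, [/\ `|s| <= `|h|, 0 <= s * h &
    g (x + h *: delta_mx 0 i) - g x = partial i g (x + s *: delta_mx 0 i) * h].
  apply: mvt_line => s; rewrite nh => sh _; apply: derivableB; [exact: dfh|exact: dfx].
rewrite nh in sh.
have [t [th _ Et]] : exists t, [/\ `|t| <= `|h|, 0 <= t * h &
    partial i f (x + s *: delta_mx 0 i + h *: delta_mx 0 j)
      - partial i f (x + s *: delta_mx 0 i) =
    partial j (partial i f) (x + s *: delta_mx 0 i + t *: delta_mx 0 j) * h].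
  by apply: mvt_line => t; rewrite nh => th _; apply: (df s t sh th).2.
rewrite nh in th.
exists s, t; split => //; rewrite -Et.
have -> : partial i f (x + s *: delta_mx 0 i + h *: delta_mx 0 j) -
    partial i f (x + s *: delta_mx 0 i) = partial i g (x + s *: delta_mx 0 i).
  rewrite -partial_shift /partial [RHS]deriveB//; [exact: dfh|exact: dfx].
exact: Es.
Qed.

(** Expanding the same second difference in both orders shows that the two mixed derivatives share a
    value, taken at two points close to [x]; continuity at [x] concludes. *)
Lemma clairaut f U x i j : open U -> U x ->
  (forall u, U u -> derivable f u (delta_mx 0 i)) ->
  (forall u, U u -> derivable f u (delta_mx 0 j)) ->
  (forall u, U u -> derivable (partial i f) u (delta_mx 0 j)) ->
  (forall u, U u -> derivable (partial j f) u (delta_mx 0 i)) ->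
  {for x, continuous (partial j (partial i f))} ->
  {for x, continuous (partial i (partial j f))} ->
  partial j (partial i f) x = partial i (partial j f) x.
Proof.
move=> oU Ux di dj dij dji cij cji; set A := LHS; set B := RHS.
apply/eqP; rewrite -subr_eq0 -normr_le0; apply/ler_addgt0Pr => e e0; rewrite add0r.
have e2 : 0 < e / 2 by rewrite divr_gt0.
have nU : nbhs x U by apply: open_nbhs_nbhs.
have nA : nbhs x [set u | `|A - partial j (partial i f) u| < e / 2].
  by have /cvgrPdist_lt /(_ _ e2) := cij.
have nB : nbhs x [set u | `|B - partial i (partial j f) u| < e / 2].
  by have /cvgrPdist_lt /(_ _ e2) := cji.
have nUAB : nbhs x (U `&` ([set u | `|A - partial j (partial i f) u| < e / 2] `&`
    [set u | `|B - partial i (partial j f) u| < e / 2])).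
  by apply: filterI => //; exact: filterI.
move/nbhs_ballP : nUAB => [d d0 near_d].
pose M := `|delta_mx 0 i : 'rV[R]_k| + `|delta_mx 0 j : 'rV[R]_k|.
have M0 : 0 <= M by rewrite addr_ge0.
(* Moving by at most [h] along each of the two axes displaces a point by at most [h * M < d]. *)
pose h := d / (1 + M).
have h0 : 0 < h by rewrite divr_gt0// ltr_wpDr.
have hM : h * M < d.
  by rewrite mulrAC ltr_pdivrMr ?ltr_wpDr// [ltRHS]mulrDr mulr1 ltrDr.
have near_st s t : `|s| <= h -> `|t| <= h ->
    ball x d (x + s *: delta_mx 0 i + t *: delta_mx 0 j).
  move=> sh th; rewrite -ball_normE /= -addrA opprD addNKr normrN.
  apply: le_lt_trans hM; apply: le_trans (ler_normD _ _) _.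
  by rewrite !normrZ [leRHS]mulrDr lerD// ler_wpM2r.
have near_ts s t : `|s| <= h -> `|t| <= h ->
    ball x d (x + s *: delta_mx 0 j + t *: delta_mx 0 i).
  by move=> sh th; rewrite addrAC; exact: near_st.
have [|s [t [sh th E1]]] := @second_difference f x i j h (ltW h0).
  move=> s t sh th p; have [Up _] := near_d _ (near_st s t sh th).
  by split; [exact: di|exact: dij].
have [|s' [t' [sh' th' E2]]] := @second_difference f x j i h (ltW h0).
  move=> s' t' sh' th' p; have [Up _] := near_d _ (near_ts s' t' sh' th').
  by split; [exact: dj|exact: dji].
have n1 : `|A - partial j (partial i f) (x + s *: delta_mx 0 i + t *: delta_mx 0 j)|
    < e / 2.
  by case: (near_d _ (near_st s t sh th)) => _ [n1 _]; exact: n1.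
have n2 : `|B - partial i (partial j f) (x + s' *: delta_mx 0 j + t' *: delta_mx 0 i)|
    < e / 2.
  by case: (near_d _ (near_ts s' t' sh' th')) => _ [_ n2]; exact: n2.
move: E1 n1; move: (partial j (partial i f) (x + _ + _)) => P E1 n1.
move: E2 n2; move: (partial i (partial j f) (x + _ + _)) => Q E2 n2.
have E : P = Q.
  have hh : h * h != 0 by rewrite mulf_neq0// gt_eqF.
  clearbody h; apply: (mulIf hh); rewrite !mulrA -E1 -E2 (addrAC x).
  move: (f (x + _ + _)) (f (x + _)) (f (x + _)) (f x) => a b c a'.
  by ring.
clearbody A B; rewrite E in n1; move: n1 n2; rewrite !ltr_norml => /andP[? ?] /andP[? ?].
by rewrite ler_norml; apply/andP; split; lra.
Qed.

End Clairaut.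

(** * Iterated partial derivatives as words in the coordinate indices *)

Section Words.
Variables (R : realType) (k : nat).
Implicit Types (f g : 'rV[R]_k -> R) (U : set 'rV[R]_k) (w : seq 'I_k).

(** Words rather than multi-indices: one more derivative is a [cons], so inductions on the order
    become inductions on lists. *)
Definition pd w f : 'rV[R]_k -> R := foldr (fun i g => partial i g) f w.

Lemma pd_cat w1 w2 f : pd (w1 ++ w2) f = pd w1 (pd w2 f).
Proof. exact: foldr_cat. Qed.

Lemma eq_partial_on U f g i : open U -> (forall x, U x -> f x = g x) ->
  forall x, U x -> partial i f x = partial i g x.
Proof.
move=> oU fg x Ux; apply: near_eq_derive.
by apply: filterS (open_nbhs_nbhs _) => [y|]; [exact: fg | split].
Qed.

Lemma Cn_on_continuous n U f x : Cn_on n U f -> U x -> {for x, continuous f}.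
Proof. by case: n => [|n] [h _]; exact: h. Qed.

Lemma Cn_on_pd n U f w : Cn_on n U f -> (size w <= n)%N ->
  Cn_on (n - size w) U (pd w f).
Proof.
move=> fn; elim: w => [|i w IH] /=; first by rewrite subn0.
by move=> wn; have := IH (ltnW wn); rewrite -(subnSK wn) => -[_ /(_ i)[]].
Qed.

Lemma pd_continuous n U f w x : Cn_on n U f -> (size w <= n)%N -> U x ->
  {for x, continuous (pd w f)}.
Proof. by move=> fn wn; apply: Cn_on_continuous (Cn_on_pd fn wn). Qed.

Lemma pd_derivable n U f w x i : Cn_on n U f -> (size w < n)%N -> U x ->
  derivable (pd w f) x (delta_mx 0 i).
Proof.
move=> fn wn Ux; have := Cn_on_pd fn (ltnW wn).
by rewrite -(subnSK wn) => -[_ /(_ i)[+ _]]; apply.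
Qed.

Lemma pd_swap n U f w i j x : open U -> Cn_on n U f -> ((size w).+1 < n)%N ->
  U x -> pd (j :: i :: w) f x = pd (i :: j :: w) f x.
Proof.
move=> oU fn wn Ux; apply: (@clairaut _ _ _ U) => //.
- by move=> u; apply: pd_derivable fn (ltnW wn).
- by move=> u; apply: pd_derivable fn (ltnW wn).
- by move=> u; apply: (@pd_derivable _ _ _ (i :: w)) fn _.
- by move=> u; apply: (@pd_derivable _ _ _ (j :: w)) fn _.
- exact: (@pd_continuous _ _ _ [:: j, i & w]) fn _ _.
- exact: (@pd_continuous _ _ _ [:: i, j & w]) fn _ _.
Qed.

(** The first letter of [w1] is brought to the front of [w2] by adjacent swaps, each an instance of
    [pd_swap]. The equality of the remaining derivatives holds on the whole open set [U], so it can
    be differentiated. *)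
Lemma pd_perm n U f w1 w2 x : open U -> Cn_on n U f -> (size w1 <= n)%N ->
  perm_eq w1 w2 -> U x -> pd w1 f x = pd w2 f x.
Proof.
move=> oU fn; elim: w1 w2 x => [|i w1 IH] w2 x /=.
  by move=> _; rewrite perm_sym => /perm_nilP ->.
move=> w1n pw Ux.
have front p q y : (size (p ++ i :: q) <= n)%N -> U y ->
    pd (p ++ i :: q) f y = pd (i :: p ++ q) f y.
  elim: p y => //= j p IHp y pn Uy.
  transitivity (pd [:: j, i & p ++ q] f y); last first.
    have pqn : ((size (p ++ q)).+1 < n)%N by move: pn; rewrite !size_cat /=; lia.
    exact: (pd_swap i j oU fn pqn Uy).
  by apply: (eq_partial_on (U := U)) => // u Uu; apply: IHp => //; exact: ltnW.
have : i \in w2 by rewrite -(perm_mem pw) mem_head.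
move=> /path.splitPr E; case: E pw => p q pw.
rewrite front//; last by rewrite -(perm_size pw).
apply: (eq_partial_on (U := U)) => // u Uu; apply: IH => //; first exact: ltnW.
by rewrite -(perm_cons i) (perm_trans pw)// -cat1s perm_catCA perm_refl.
Qed.

Lemma mpartial_pd (alpha : 'I_k -> nat) f :
  mpartial alpha f = pd (flatten [seq nseq (alpha i) i | i <- enum 'I_k]) f.
Proof.
rewrite /mpartial; elim: (enum 'I_k) => //= i s ->; rewrite pd_cat.
by elim: (alpha i) => //= m ->.
Qed.

Lemma pd_mpartial n U f D w : open U -> Cn_on n U f -> (size w <= n)%N ->
  (size w <= D)%N ->
  exists2 alpha : {ffun 'I_k -> 'I_D.+1}, (\sum_(i < k) alpha i <= D)%N &
    forall x, U x -> pd w f x = mpartial (fun i => nat_of_ord (alpha i)) f x.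
Proof.
(* The multi-index counts the occurrences of each letter; they number at most [size w <= D], so
   [inord] preserves them. *)
move=> oU fn wn wD; exists [ffun i => inord (count_mem i w)].
  under eq_bigr => i _.
    rewrite ffunE inordK; last by rewrite ltnS (leq_trans (count_size _ _)).
    over.
  suff -> : (\sum_(i < k) count_mem i w)%N = size w by [].
  elim: (w) => [|j s IH] /=; first by rewrite big1.
  by rewrite big_split/= IH (bigD1 j)//= eqxx big1// => i; rewrite eq_sym => /negbTE ->.
move=> x Ux; rewrite mpartial_pd; apply: (pd_perm oU fn wn) => //.
apply/permP => a; rewrite count_flatten -map_comp sumnE big_map big_enum /=.
under eq_bigr => i _.
  rewrite /= count_nseq ffunE inordK; last by rewrite ltnS (leq_trans (count_size _ _)).
  over.
elim: (w) => [|j s IH] /=; first by rewrite big1// => i _; rewrite muln0.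
under eq_bigr do rewrite mulnDr.
rewrite big_split/= -IH (bigD1 j)//= eqxx muln1 big1 ?addn0// => i.
by rewrite eq_sym => /negbTE ->; rewrite muln0.
Qed.

Lemma mpartial_word (alpha : 'I_k -> nat) f : exists2 w : seq 'I_k,
  size w = (\sum_(i < k) alpha i)%N & mpartial alpha f = pd w f.
Proof.
exists (flatten [seq nseq (alpha i) i | i <- enum 'I_k]); last exact: mpartial_pd.
rewrite size_flatten /shape -map_comp sumnE big_map big_enum /=.
by apply: eq_bigr => i _; rewrite /= size_nseq.
Qed.

End Words.

(** * Uniform bounds from the levelset condition *)

Arguments Cn_on : simpl never.

Section Levelset.
Variables (R : realType) (k : nat).
Implicit Types (x y z u : 'rV[R]_k) (B : 'rV[R]_k * R) (f : 'rV[R]_k -> R).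
Implicit Types (w : seq 'I_k).

Lemma edist_continuous x : continuous (edist x).
Proof.
pose F i z := (x 0 i - z 0 i) ^+ 2.
have CF : continuous (fun z => \sum_(i < k) F i z).
  apply: continuous_big => [|i _ y]; first exact: add_continuous.
  have C : {for y, continuous (fun z : 'rV[R]_k => x 0 i - z 0 i)}.
    apply: (@continuousB _ _ _ (fun=> x 0 i) (fun z : 'rV[R]_k => z 0 i)).
      exact: cst_continuous.
    exact: coord_continuous.
  exact: (continuousM C C).
by move=> y; apply: (continuous_comp (CF y)); exact: sqrt_continuous.
Qed.

Lemma eball_compact B : compact (eball B).
Proof.
pose side i : set R := `[B.1 0 i - B.2, B.1 0 i + B.2]%classic.
pose box := [set v : 'rV[R]_k | forall i, side i (v ord0 i)].
apply: (@subclosed_compact _ _ box).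
- apply: (@preimage_closed _ _ (edist B.1) [set r | r <= B.2]); last exact: closed_le.
  by move=> y _; exact: edist_continuous.
- by apply: (@rV_compact R k side) => i; exact: segment_compact.
- move=> y By i; rewrite /side /=; have := le_trans (coord_le_edist B.1 y i) By.
  by rewrite in_itv/= ler_norml => /andP[? ?]; apply/andP; split; lra.
Qed.

Lemma eball_bounded B f :
  (forall x, eball B x -> {for x, continuous f}) ->
  exists M, forall x, eball B x -> `|f x| <= M.
Proof.
move=> fc; have [[c Bc]|noB] := pselect (eball B !=set0); last first.
  by exists 0 => x Bx; exfalso; apply: noB; exists x.
have [||c' _ fmax] :=
  @compact_EVT_max _ _ (fun x => `|f x|) (eball B) _ (@eball_compact B).
- by exists c.
- apply: continuous_in_subspaceT => x /set_mem Bx.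
  apply: (@continuous_comp _ _ _ f (fun r : R => `|r|)); first exact: fc.
  exact: norm_continuous.
by exists `|f c'| => x Bx; apply: fmax; apply/mem_set.
Qed.

(** Needed for the [sup] in [Cnorm] to be a genuine supremum. Each of the finitely many derivatives
    is bounded by compactness of the ball. *)
Lemma Cnorm_ubound D B f U : eball B `<=` U -> Cn_on D U f ->
  has_ubound [set Cnorm_at D f x | x in eball B].
Proof.
move=> BU fD.
have /choice[M HM] : forall alpha : {ffun 'I_k -> 'I_D.+1}, exists M,
    (\sum_(i < k) alpha i <= D)%N -> forall x, eball B x ->
    `|mpartial (fun i => nat_of_ord (alpha i)) f x| <= M.
  move=> alpha.
  (* Multi-indices of order above [D] receive the dummy bound 0. *)
  have [aD|/negP aD] := boolP (\sum_(i < k) alpha i <= D)%N; last by exists 0.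
  have [w wa ->] := mpartial_word (fun i => nat_of_ord (alpha i)) f.
  have [|M HM] := @eball_bounded B (pd w f).
    by move=> x /BU Ux; apply: (pd_continuous fD) => //; rewrite wa.
  by exists M.
exists (\big[Num.max/0]_(alpha : {ffun 'I_k -> 'I_D.+1}) M alpha) => _ [x Bx <-].
apply: bigmax_le => [|alpha aD]; first exact: bigmax_ge_id.
by apply: le_trans (HM _ aD x Bx) (le_bigmax _ _ _).
Qed.

Lemma pd_le_Cnorm D B f U w x : open U -> eball B `<=` U -> Cn_on D U f ->
  (size w <= D)%N -> eball B x -> `|pd w f x| <= Cnorm D (eball B) f.
Proof.
move=> oU BU fD wD Bx; have [alpha aD ->] := pd_mpartial oU fD wD wD; last exact: BU.
apply: le_trans (ub_le_sup (Cnorm_ubound BU fD) _); last by exists x.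
exact: (le_bigmax_cond _ (fun beta : {ffun 'I_k -> 'I_D.+1} =>
  `|mpartial (fun i => nat_of_ord (beta i)) f x|)).
Qed.

Lemma Cn_onS n U f : Cn_on n.+1 U f -> Cn_on n U f.
Proof.
elim: n f => [|n IH] f [fc df]; first by [].
by split=> // i; have [di ci] := df i; split=> //; exact: IH.
Qed.

(** If all these derivatives stayed below [c], so would the supremum; [0 < c] covers the value 0
    from which the maximum in [Cnorm_at] starts. *)
Lemma Cnorm_attained D B f (c : R) : eball B !=set0 -> 0 < c ->
  c < Cnorm D (eball B) f ->
  exists w x, [/\ (size w <= D)%N, eball B x & c <= `|pd w f x|].
Proof.
move=> [x0 Bx0] c0; apply: contraPP => H; apply/negP; rewrite -leNgt.
apply: ge_sup; first by exists (Cnorm_at D f x0), x0.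
move=> _ [x Bx <-]; apply: bigmax_le => [|alpha aD]; first exact: ltW.
have [w wa ->] := mpartial_word (fun i => nat_of_ord (alpha i)) f.
by rewrite leNgt; apply/negP => /ltW cw; apply: H; exists w, x; rewrite wa.
Qed.

(** Here [M] is the norm of order [D], positive because [f] is nonzero somewhere on the ball. Asking
    for [M / 2] only leaves room below the supremum. *)
Lemma levelset_legal_bounds D (C1 : R) B A : levelset_legal D C1 B A ->
  exists f U M, [/\ [/\ open U, eball B `<=` U, Cn_on D.+1 U f & 0 < M],
    A = [set x | eball B x /\ f x = 0],
    forall w x, (size w <= D.+1)%N -> eball B x -> `|pd w f x| <= C1 * M &
    exists w x, [/\ (size w <= D)%N, eball B x & M / 2 <= `|pd w f x|]].
Proof.
move=> [f [[U [oU BU fD]] [x0 Bx0 fx0] fC AE]].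
have fD' := Cn_onS fD.
have M0 : 0 < Cnorm D (eball B) f.
  apply: lt_le_trans (pd_le_Cnorm oU BU fD' (leq0n D : (size [::] <= D)%N) Bx0).
  by rewrite /= normr_gt0.
exists f, U, (Cnorm D (eball B) f); split => //.
- move=> w x wD Bx; exact: le_trans (pd_le_Cnorm oU BU fD wD Bx) fC.
- by apply: Cnorm_attained; [exists x0 | rewrite divr_gt0 | rewrite ltr_pdivrMr//; lra].
Qed.

End Levelset.

(** * Forcing in the hyperplane game *)

Section Force.
Variables (R : realType) (k : nat) (beta : R).
Hypotheses (k0 : (0 < k)%N) (beta0 : 0 < beta).
Notation ball := ('rV[R]_k * R)%type.
Implicit Types (P Q : ball -> Prop) (B : ball).

(** A well-founded tree of Alice's moves whose leaves satisfy [P]. A position where Bob is stuck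
    counts as forced, the second premise being vacuous there. *)
Inductive force P : ball -> Prop :=
| force_now B : P B -> force P B
| force_move B A : affine_hyperplane A ->
    (forall B', bob_legal beta B A B' -> force P B') -> force P B.

Lemma force_bind P Q B : force P B -> (forall B', P B' -> force Q B') -> force Q B.
Proof.
move=> fP PQ; elim: fP => [B1 /PQ//|B1 A hA _ IH].
exact: force_move hA IH.
Qed.

Lemma force_mono P Q B : (forall B', P B' -> Q B') -> force P B -> force Q B.
Proof. by move=> PQ fP; apply: force_bind fP _ => B' /PQ; exact: force_now. Qed.

(** The hyperplane passes through the center of [B], and [B'] must lie strictly on one side of it.
    With [d] the signed distance of the new center, [B'.2 < |d|] and [|d| + B'.2 <= B.2]. *)
Lemma central_hyperplane B : 0 < B.2 -> exists2 A, affine_hyperplane A &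
  forall B', bob_legal beta B A B' -> B'.2 <= B.2 / 2.
Proof.
move=> r0; pose i := Ordinal k0; pose e : 'rV[R]_k := delta_mx 0 i.
have eE y : \sum_(l < k) e 0 l * y 0 l = y 0 i :> R.
  rewrite (bigD1 i)//= big1 => [|l /negbTE li]; rewrite !mxE ?li ?eqxx ?mul0r//.
  by rewrite mul1r addr0.
exists [set x : 'rV[R]_k | \sum_(l < k) e 0 l * x 0 l = B.1 0 i].
  exists e, (B.1 0 i); split=> //; apply/eqP => /rowP/(_ i)/eqP.
  by rewrite !mxE !eqxx oner_eq0.
move=> B' [sub rad]; pose d := B'.1 0 i - B.1 0 i.
have r'0 : 0 < B'.2 by apply: lt_le_trans rad; rewrite mulr_gt0.
have coord t : (B'.1 + t *: e) 0 i = B'.1 0 i + t by rewrite !mxE !eqxx mulr1.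
have far : B'.2 < `|d|.
  rewrite ltNge; apply/negP => dr.
  have Bp : eball B' (B'.1 + (- d) *: e) by apply: eball_delta; rewrite normrN.
  have [_] := sub _ Bp; apply; exists (B'.1 + (- d) *: e).
    by rewrite /= eE coord /d; ring.
  by rewrite edistxx mulr_gt0.
have h t : `|t| <= B'.2 -> `|d + t| <= B.2.
  move=> /(eball_delta i)/sub[+ _]; apply: le_trans.
  have -> : d + t = (B'.1 + t *: e) 0 i - B.1 0 i by rewrite coord /d; ring.
  by rewrite distrC; exact: coord_le_edist.
have := h B'.2; have := h (- B'.2).
rewrite normrN (gtr0_norm r'0) lexx => /(_ isT) + /(_ isT).
move: far; clearbody d; rewrite !ler_norml => far /andP[h1 h2] /andP[h3 h4].
rewrite ler_pdivlMr//; move: far; case: (ger0P d) => d0; lra.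
Qed.

(** Alice halves the radius until it is at most [r]. The last move starts from a radius above [r],
    which gives the lower bound [beta * r]; the other alternative covers the case without any
    move. *)
Lemma force_shrink r B : 0 < r -> 0 < B.2 ->
  force (fun B' => [/\ eball B' `<=` eball B, B'.2 <= r &
                     beta * r <= B'.2 \/ B.2 <= B'.2]) B.
Proof.
move=> r0; have [n] : exists n, B.2 <= r * 2 ^+ n.
  exists (Num.bound (B.2 / r)); rewrite mulrC -ler_pdivrMr//.
  have [B0|B0] := leP 0 (B.2 / r); last by apply: le_trans (ltW B0) _; rewrite exprn_ge0.
  apply: le_trans (ltW (archi_boundP B0)) _.
  by rewrite -natrX ler_nat ltnW// ltn_expl.
elim: n B => [|n IH] B Bn B0.
  by apply: force_now; rewrite expr0 mulr1 in Bn; split=> //; right.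
have [Br|rB] := leP B.2 r; first by apply: force_now; split=> //; right.
have [A hA half] := central_hyperplane B0.
apply: (force_move hA) => B1 legal; have [sub rad] := legal.
have B1le := half _ legal.
have B10 : 0 < B1.2 by apply: lt_le_trans rad; rewrite mulr_gt0.
apply: force_mono (IH B1 _ B10) => [B2 [sub2 B2r lo]|].
  split=> //; first by move=> y /sub2/sub[].
  left; case: lo => // lo; apply: le_trans (le_trans rad lo).
  by rewrite ler_pM2l// ltW.
by rewrite exprS in Bn; lra.
Qed.

(** Off the neighbourhood of the tangent hyperplane, the affine approximation of [g] is at least
    [beta * r * c] in absolute value. The remainder is at most [k ^ 2 * L * r ^ 2], which the last
    hypothesis makes at most half of that. *)
Lemma tangent_hyperplane B (g : 'rV[R]_k -> R) i (c L : R) : 0 < B.2 -> 0 < c ->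
  (forall u l, eball B u -> derivable g u (delta_mx 0 l)) ->
  (forall u l m, eball B u -> derivable (partial l g) u (delta_mx 0 m)) ->
  (forall u l m, eball B u -> `|partial m (partial l g) u| <= L) ->
  (forall u, eball B u -> c <= `|partial i g u|) ->
  2 * k%:R ^+ 2 * L * B.2 <= beta * c ->
  exists2 A, affine_hyperplane A & forall B', bob_legal beta B A B' ->
    forall y, eball B' y -> beta * B.2 * c / 2 <= `|g y|.
Proof.
move: B => [x r] /= r0 c0 dg ddg Lg cg small.
pose a : 'rV[R]_k := \row_l partial l g x.
have Bx : eball (x, r) x by apply: eball_center; exact: ltW.
have L0 : 0 <= L by apply: le_trans (Lg _ i i Bx).
pose na := edist 0 a.
have na2 : na ^+ 2 = \sum_(l < k) a 0 l ^+ 2.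
  rewrite /na /edist sqr_sqrtr ?sumr_ge0// => [|l _]; last exact: sqr_ge0.
  by apply: eq_bigr => l _; rewrite mxE sub0r sqrrN.
have cna : c <= na.
  apply: le_trans (cg _ Bx) _; apply: le_trans (coord_le_edist 0 a i).
  by rewrite !mxE sub0r normrN.
have na0 : 0 < na := lt_le_trans c0 cna.
pose lin (y : 'rV[R]_k) : R := \sum_(l < k) a 0 l * y 0 l.
exists [set y | lin y = lin x - g x].
  exists a, (lin x - g x); split=> //; apply/eqP => a0.
  by move: na0; rewrite /na a0 edistxx ltxx.
move=> B' [sub _] y /sub[By] /=.
(* [v] is the affine approximation of [g] at [y], and [p] is the orthogonal projection of [y] onto
   its zero set. *)
pose v := lin y - (lin x - g x); pose p := y + (- v / na ^+ 2) *: a.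
have linp : lin p = lin x - g x.
  have -> : lin p = lin y + (- v / na ^+ 2) * \sum_(l < k) a 0 l ^+ 2.
    rewrite /lin mulr_sumr -big_split; apply: eq_bigr => l _.
    by rewrite !mxE /=; ring.
  by rewrite -na2 mulfVK ?expf_eq0 ?gt_eqF// /v; ring.
have distp : edist y p = `|v| / na.
  rewrite edistD -/na normrM normrN normfV (ger0_norm (exprn_ge0 2 (ltW na0))).
  by rewrite -mulrA; congr (_ * _); field; rewrite gt_eqF.
move=> notthick; have vlow : beta * r * c <= `|v|.
  have : beta * r <= `|v| / na.
    by rewrite leNgt -distp; apply/negP => yp; apply: notthick; exists p.
  rewrite ler_pdivlMr// => h; apply: le_trans h.
  by rewrite ler_wpM2l// mulr_ge0// ltW.
(* [mvt_eball] with zero slopes is a Lipschitz bound, here for the components of the gradient. *)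
have da u l : eball (x, r) u -> `|partial l g u - a 0 l| <= L * (k%:R * r).
  move=> Bu; have := @mvt_eball _ _ (x, r) (partial l g) (fun=> 0) L.
  move=> /(_ (fun u m => ddg u l m)).
  have H : forall u0 i0, eball (x, r) u0 -> `|partial i0 (partial l g) u0 - 0| <= L.
    by move=> u0 m Bu0; rewrite subr0; exact: Lg.
  move=> /(_ H u x Bu Bx); rewrite big1 ?subr0 => [h|m _]; last by rewrite mul0r.
  rewrite mxE; apply: le_trans h _; rewrite ler_wpM2l//.
  have := sum_coord_le_edist x u; under eq_bigr do rewrite distrC.
  by move=> h; apply: le_trans h _; rewrite ler_wpM2l.
(* With the gradient at [x] as slopes, the same inequality bounds the remainder of the first-order
   expansion. *)
have := mvt_eball dg da By Bx.
have -> : g y - g x - \sum_(l < k) a 0 l * (y 0 l - x 0 l) = g y - v.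
  have -> : \sum_(l < k) a 0 l * (y 0 l - x 0 l) = lin y - lin x.
    by rewrite /lin -sumrB; apply: eq_bigr => l _; rewrite mulrBr.
  by rewrite /v; ring.
move=> h; have {h} : `|g y - v| <= L * (k%:R * r) * (k%:R * r).
  apply: le_trans h _; apply: ler_wpM2l; first by rewrite mulr_ge0// mulr_ge0// ltW.
  have := sum_coord_le_edist x y; under eq_bigr do rewrite distrC.
  by move=> h; apply: le_trans h _; rewrite ler_wpM2l.
have -> : L * (k%:R * r) * (k%:R * r) = 2 * k%:R ^+ 2 * L * r * r / 2 by field.
have : 2 * k%:R ^+ 2 * L * r * r <= beta * c * r by rewrite ler_wpM2r// ltW.
clearbody v; move=> h1 h2; have := ler_normD (g y) (v - g y); rewrite addrC subrK distrC.
by move: (g y) h2 vlow => gy *; lra.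
Qed.

End Force.

(** * From a large derivative to a lower bound on the function *)

Section Chain.
Variables (R : realType) (k : nat) (beta : R).
Hypotheses (k0 : (0 < k)%N) (beta0 : 0 < beta).
Notation ball := ('rV[R]_k * R)%type.
Implicit Types (B : ball) (f : 'rV[R]_k -> R) (w : seq 'I_k) (D : nat).

(** Each induction step strips one letter from [w] by shrinking the ball and playing a tangent
    hyperplane. The constants [c'] and [t'] are fixed before [rho], [N], [f] and the ball, so one
    [beta'] will serve for all rounds. *)
Lemma force_nonvanishing D (K : R) n : (n <= D)%N -> 0 < K ->
  forall c t : R, 0 < c -> 0 < t ->
  exists c' t' : R, [/\ 0 < c', 0 < t' &
    forall rho N U f B w, 0 < rho -> 0 < N -> Cn_on D.+1 U f -> eball B `<=` U ->
    (forall v y, (size v <= D.+1)%N -> eball B y ->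
       rho ^+ size v * `|pd v f y| <= K * N) ->
    (size w <= n)%N -> t * rho <= B.2 ->
    (forall y, eball B y -> c * N <= rho ^+ size w * `|pd w f y|) ->
    force beta (fun B' => [/\ eball B' `<=` eball B, t' * rho <= B'.2 &
                           forall y, eball B' y -> c' * N <= `|f y|]) B].
Proof.
move=> nD K0; elim: n nD => [|n IH] nD c t c0 t0.
  exists c, t; split=> // rho N U f B [|//] _ _ _ _ _ _ tB cf.
  by apply: force_now; split=> // y /cf; rewrite expr0 mul1r.
have k0' : 0 < k%:R :> R by rewrite ltr0n.
(* Chosen so that the smallness hypothesis of [tangent_hyperplane] is an equality at radius
   [s * rho]. *)
pose s := beta * c / (2 * k%:R ^+ 2 * K).
have s0 : 0 < s by rewrite divr_gt0 ?mulr_gt0 ?exprn_gt0.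
(* After shrinking, the radius is at least [m * rho], whether or not any move was made. *)
pose m := Num.min t (beta * s).
have m0 : 0 < m by rewrite lt_min t0 mulr_gt0.
have [||c1 [t1 [c10 t10 IHn]]] := IH (ltnW nD) (beta * c * m / 2) (beta * m).
- by rewrite divr_gt0// !mulr_gt0.
- by rewrite mulr_gt0.
(* The minima account for the empty word, where Alice stops at once with [c] and [t]. *)
exists (Num.min c c1), (Num.min t t1); split; rewrite ?lt_min ?c0 ?t0//.
move=> rho N U f B [|i w] rho0 N0 fD BU Kf wn tB cf.
  apply: force_now; split=> // [|y /cf].
    by apply: le_trans tB; rewrite ler_pM2r// ge_min lexx.
  by rewrite expr0 mul1r => h; apply: le_trans h; rewrite ler_pM2r// ge_min lexx.
have B0 : 0 < B.2 by apply: lt_le_trans tB; rewrite mulr_gt0.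
apply: force_bind (force_shrink k0 beta0 (mulr_gt0 s0 rho0) B0) _ => B1 [B1B B1s B1lo].
have mB1 : m * rho <= B1.2.
  case: B1lo => [h|/(le_trans tB) h]; apply: le_trans h; last first.
    by rewrite ler_pM2r// ge_min lexx.
  by rewrite mulrA ler_pM2r// ge_min lexx orbT.
have B10 : 0 < B1.2 by apply: lt_le_trans mB1; rewrite mulr_gt0.
have B1U : eball B1 `<=` U by move=> y /B1B/BU.
have wD : (size w < D)%N by apply: leq_trans nD.
have rhoX j : 0 < rho ^+ j by rewrite exprn_gt0.
have [||||||A hA nz] := @tangent_hyperplane _ _ beta beta0 B1 (pd w f) i
    (c * N / rho ^+ (size w).+1) (K * N / rho ^+ (size w).+2) B10.
- by rewrite divr_gt0// mulr_gt0.
- by move=> u l /B1U Uu; apply: pd_derivable fD _ Uu; exact: ltnW.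
- by move=> u l j /B1U Uu; apply: (@pd_derivable _ _ _ _ _ (l :: w)) fD _ Uu.
- move=> u l j /B1B Bu; rewrite ler_pdivlMr// mulrC.
  exact: (Kf [:: j, l & w]).
- by move=> u /B1B Bu; rewrite ler_pdivrMr// [leRHS]mulrC; exact: cf.
- have -> : beta * (c * N / rho ^+ (size w).+1) =
      2 * k%:R ^+ 2 * (K * N / rho ^+ (size w).+2) * (s * rho).
    by rewrite /s !exprS; field; rewrite !gt_eqF ?exprn_gt0.
  by rewrite ler_wpM2l// !mulr_ge0 ?exprn_ge0 ?invr_ge0 ?ltW.
apply: (force_move hA) => B2 legal; have [sub2 rad2] := legal.
have B2B1 : eball B2 `<=` eball B1 by move=> y /sub2[].
apply: force_mono (IHn rho N U f B2 w rho0 N0 fD _ _ wn _ _) => [B3 [B32 tB3 cB3]||||].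
- split; first by move=> y /B32/B2B1/B1B.
    by apply: le_trans tB3; rewrite ler_pM2r// ge_min lexx orbT.
  by move=> y /cB3 h; apply: le_trans h; rewrite ler_pM2r// ge_min lexx orbT.
- by move=> y /B2B1/B1U.
- by move=> v y vD /B2B1/B1B; exact: Kf.
- by apply: le_trans rad2; rewrite -mulrA ler_pM2l.
move=> y B2y; have := nz _ legal _ B2y; rewrite -(ler_pM2l (rhoX (size w))).
apply: le_trans.
have -> : rho ^+ size w * (beta * B1.2 * (c * N / rho ^+ (size w).+1) / 2) =
    beta * c * (B1.2 / rho) / 2 * N.
  by rewrite !exprS; field; rewrite !gt_eqF ?exprn_gt0.
rewrite ler_pM2r// ler_pM2r// ler_pM2l ?mulr_gt0//.
by rewrite ler_pdivlMr.
Qed.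

(* Derivatives of order [j] are weighted by [rho ^ j], which makes every
   constant below independent of the radius [rho] of the ball. *)
Lemma scaled_bounds D (C1 : R) B f U (M : R) x :
  0 < C1 -> 0 < B.2 -> B.2 <= 1 -> 8 * k%:R * C1 * B.2 <= 1 -> 0 < M ->
  Cn_on D.+1 U f -> eball B `<=` U -> eball B x ->
  (forall w y, (size w <= D.+1)%N -> eball B y -> `|pd w f y| <= C1 * M) ->
  (exists w y, [/\ (size w <= D)%N, eball B y & M / 2 <= `|pd w f y|]) ->
  exists2 w, (size w <= D)%N &
    let N := B.2 ^+ size w * `|pd w f x| in 0 < N /\
    forall v y, (size v <= D.+1)%N -> eball B y ->
      B.2 ^+ size v * `|pd v f y| <= (1 + 2 * k%:R) ^+ D.+1 * N.
Proof.
case: B => c rho /= C10 rho0 rho1 small M0 fD BU Bx ub [w0 [x0 [w0D Bx0 low]]].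
have k0' : 1 <= k%:R :> R by rewrite ler1n.
have lip w L : (size w <= D)%N ->
    (forall i u, eball (c, rho) u -> `|pd (i :: w) f u| <= L) ->
    forall y z, eball (c, rho) y -> eball (c, rho) z ->
    `|pd w f y - pd w f z| <= L * (2 * k%:R * rho).
  move=> wD Lw y z By Bz.
  have dw u i : eball (c, rho) u -> derivable (pd w f) u (delta_mx 0 i).
    by move=> /BU Uu; exact: (pd_derivable fD wD Uu).
  have Lw0 u i : eball (c, rho) u -> `|partial i (pd w f) u - 0| <= L.
    by move=> Bu; rewrite subr0; exact: Lw.
  have := @mvt_eball _ _ (c, rho) (pd w f) (fun=> 0) L dw Lw0 y z By Bz.
  rewrite big1 ?subr0 => [h|i _]; last by rewrite mul0r.
  apply: le_trans h _; apply: ler_wpM2l; last exact: (sum_coord_le_eball By Bz).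
  exact: le_trans (Lw (Ordinal k0) _ Bx).
(* From [x0] to [x] this derivative changes by at most [C1 * M * (2 * k * rho)]; the factor 8 in
   [small] makes this at most [M / 4]. *)
have low0 : M / 4 <= `|pd w0 f x|.
  have h : `|pd w0 f x0 - pd w0 f x| <= M / 4.
    apply: le_trans (lip _ _ w0D (fun i u => ub (i :: w0) u w0D) _ _ Bx0 Bx) _.
    have -> : C1 * M * (2 * k%:R * rho) = 8 * k%:R * C1 * rho * M / 4 by field.
    by rewrite ler_pM2r// -[leRHS]mul1r ler_pM2r.
  have := ler_normD (pd w0 f x0 - pd w0 f x) (pd w0 f x); rewrite subrK.
  by move: (pd w0 f x0) (pd w0 f x) h low => a b h low h'; lra.
pose G (w : D.-bseq 'I_k) := rho ^+ size w * `|pd w f x|.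
(* Words of length at most [D] form a finite type, so some [w] maximizes the weighted derivative at
   [x]. *)
have [w _ wmax] := @Order.TotalTheory.arg_maxP _ _ _ [bseq] xpredT G isT.
have {}wmax v : (size v <= D)%N ->
    rho ^+ size v * `|pd v f x| <= rho ^+ size w * `|pd w f x|.
  by move=> vD; exact: (wmax (Bseq vD)).
exists w; first exact: size_bseq.
set N := rho ^+ size w * _ in wmax * => /=.
have rhoD : rho ^+ D * (M / 4) <= N.
  apply: le_trans (wmax _ w0D); apply: ler_pM => //.
  - by apply: exprn_ge0; exact: ltW.
  - by apply: divr_ge0 => //; exact: ltW.
  - by apply: ler_wiXn2l => //; exact: ltW.
have N0 : 0 < N by apply: lt_le_trans rhoD; rewrite mulr_gt0 ?exprn_gt0 ?divr_gt0.
split=> //; clearbody N.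
(* Descending induction on the order. At order [D.+1] the bound [C1 * M] and the smallness of [rho]
   suffice. Below, the value at [x] is at most [N] and the variation at most [2 * k] times the
   previous bound, whence a factor [1 + 2 * k] per order. *)
have {}ub j v y : (size v + j = D.+1)%N -> eball (c, rho) y ->
    rho ^+ size v * `|pd v f y| <= (1 + 2 * k%:R) ^+ j * N.
  elim: j v y => [|j IH] v y vj By.
    rewrite addn0 in vj; rewrite vj expr0 mul1r; apply: le_trans rhoD.
    have small4 : 4 * C1 * rho <= 1.
      apply: le_trans small.
      have -> : 8 * k%:R * C1 * rho = 2 * k%:R * (4 * C1 * rho) by ring.
      by apply: ler_peMl; [rewrite !mulr_ge0// ltW | lra].
    have := ub v y (eq_leq vj) By; rewrite -(ler_pM2l (exprn_gt0 D.+1 rho0)).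
    move=> h; apply: le_trans h _.
    have -> : rho ^+ D.+1 * (C1 * M) = 4 * C1 * rho * (rho ^+ D * (M / 4)).
      by rewrite exprS; field.
    by apply: ler_piMl; rewrite // mulr_ge0 ?exprn_ge0 ?divr_ge0// ltW.
  have vD : (size v <= D)%N by move: vj; rewrite addnS => -[<-]; exact: leq_addr.
  have szv0 : 0 < rho ^+ size v by rewrite exprn_gt0.
  have := lip v ((1 + 2 * k%:R) ^+ j * N / rho ^+ (size v).+1) vD _ y x By Bx.
  have H : forall i u, eball (c, rho) u ->
      `|pd (i :: v) f u| <= (1 + 2 * k%:R) ^+ j * N / rho ^+ (size v).+1.
    move=> i u Bu; rewrite ler_pdivlMr ?exprn_gt0// mulrC.
    by apply: (IH (i :: v)) => //; rewrite /= addSnnS.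
  move=> /(_ H); rewrite -(ler_pM2l szv0).
  have -> : rho ^+ size v *
      ((1 + 2 * k%:R) ^+ j * N / rho ^+ (size v).+1 * (2 * k%:R * rho)) =
      (1 + 2 * k%:R) ^+ j * N * (2 * k%:R).
    by rewrite exprS; field; rewrite !gt_eqF.
  have -> : (1 + 2 * k%:R) ^+ j.+1 * N = (1 + 2 * k%:R) * ((1 + 2 * k%:R) ^+ j * N).
    by rewrite exprS mulrA.
  have := wmax v vD.
  have : N <= (1 + 2 * k%:R) ^+ j * N.
    by apply: ler_peMl; [exact: ltW | apply: exprn_ege1; lra].
  move: ((1 + 2 * k%:R) ^+ j * N) => P h1 h2 h3.
  have := ler_normD (pd v f y - pd v f x) (pd v f x); rewrite subrK.
  rewrite -(ler_pM2l szv0) mulrDr => h4; apply: le_trans h4 _.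
  by rewrite mulrDl mul1r; lra.
move=> v y vD By; have := ub (D.+1 - size v)%N v y (subnKC vD) By.
move=> h; apply: le_trans h _; rewrite ler_pM2r//.
by apply: ler_weXn2l; [lra | exact: leq_subr].
Qed.

End Chain.

(** One round of the levelset game is won by finitely many hyperplane moves. The first hyperplane is
    kept apart from [force], whose tree may be a bare leaf, so that the simulation has an answer to
    give as soon as a round begins. *)
Lemma levelset_step (R : realType) (k : nat) (beta : R) D (C1 : R) :
  (0 < k)%N -> 0 < beta -> 0 < C1 ->
  exists beta' rho' : R, [/\ 0 < beta', 0 < rho' &
    forall (B : 'rV[R]_k * R) A, 0 < B.2 -> B.2 <= rho' ->
      levelset_legal D C1 B A ->
      exists2 H, affine_hyperplane H & forall B', bob_legal beta B H B' ->
        force beta (bob_legal beta' B A) B'].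
Proof.
move=> k0 beta0 C10.
have k0' : 0 < k%:R :> R by rewrite ltr0n.
pose K : R := (1 + 2 * k%:R) ^+ D.+1.
have K0 : 0 < K by rewrite exprn_gt0; lra.
(* Within [s * B.2] of the center, the weighted derivative chosen there varies by at most
   [N / 2]. *)
pose s := (2 * k%:R * K)^-1.
have s0 : 0 < s by rewrite invr_gt0 !mulr_gt0.
have half0 : 0 < 2^-1 :> R by rewrite invr_gt0.
pose t := Num.min beta (beta * s).
have t0 : 0 < t by rewrite lt_min beta0 mulr_gt0.
have [c' [t' [c'0 t'0 chain]]] := force_nonvanishing k0 beta0 (leqnn D) K0 half0 t0.
(* The first term ensures Bob's radius condition. The second is the distance, relative to [B.2],
   over which [f], of Lipschitz constant at most [k * K * N / B.2], can fall from [c' * N] to 0. *)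
pose beta' := Num.min t' (c' / (k%:R * K)).
have kK0 : 0 < k%:R * K by rewrite mulr_gt0.
exists beta', (Num.min 1 (8 * k%:R * C1)^-1); split.
- by rewrite lt_min t'0 divr_gt0.
- by rewrite lt_min ltr01 invr_gt0 !mulr_gt0.
move=> B A B0; rewrite le_min => /andP[B1 Bsmall] /levelset_legal_bounds.
move=> [f [U [M [[oU BU fD M0] -> ub low]]]].
have small : 8 * k%:R * C1 * B.2 <= 1.
  by rewrite mulrC -ler_pdivlMr ?mul1r// !mulr_gt0.
have [H hH half] := central_hyperplane k0 beta0 B0.
exists H => // B1' legal; have [sub1 rad1] := legal.
have B10 : 0 < B1'.2 by apply: lt_le_trans rad1; rewrite mulr_gt0.
have B1B : eball B1' `<=` eball B by move=> y /sub1[].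
apply: force_bind (force_shrink k0 beta0 (mulr_gt0 s0 B0) B10) _ => B2 [B21 B2s B2lo].
have tB2 : t * B.2 <= B2.2.
  case: B2lo => [h|/(le_trans rad1) h]; apply: le_trans h; last first.
    by rewrite ler_pM2r// ge_min lexx.
  by rewrite mulrA ler_pM2r// ge_min lexx orbT.
have B20 : 0 < B2.2 by apply: lt_le_trans tB2; rewrite mulr_gt0.
have B2B : eball B2 `<=` eball B by move=> y /B21/B1B.
(* The word [w] is selected at the center of [B2], but the weights use the radius of the original
   ball [B], where the bounds hold. *)
have B2c : eball B2 B2.1 by case: (B2) B20 => x r /= /ltW; exact: eball_center.
have [w wD /=] := scaled_bounds k0 C10 B0 B1 small M0 fD BU (B2B _ B2c) ub low.
rewrite -/K; set N := _ * `|_| => -[N0 Kub].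
have NE : N = B.2 ^+ size w * `|pd w f B2.1| by [].
clearbody N.
have rhoX j : 0 < B.2 ^+ j by rewrite exprn_gt0.
have grad v y i : (size v <= D)%N -> eball B y ->
    `|partial i (pd v f) y| <= K * N / B.2 ^+ (size v).+1.
  by move=> vD By; rewrite ler_pdivlMr// mulrC; exact: (Kub (i :: v)).
have lip (B' : 'rV[R]_k * R) v y z : (size v <= D)%N -> eball B' `<=` eball B ->
    eball B' y -> eball B' z ->
    `|pd v f y - pd v f z| <= K * N / B.2 ^+ (size v).+1 * (k%:R * edist y z).
  move=> vD B'B By Bz.
  have dv u i : eball B' u -> derivable (pd v f) u (delta_mx 0 i).
    by move=> /B'B/BU Uu; exact: (pd_derivable fD vD Uu).
  have Lv u i : eball B' u ->
      `|partial i (pd v f) u - 0| <= K * N / B.2 ^+ (size v).+1.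
    by move=> /B'B Bu; rewrite subr0; exact: grad.
  have := @mvt_eball _ _ B' (pd v f) (fun=> 0) _ dv Lv y z By Bz.
  rewrite big1 ?subr0 => [h|i _]; last by rewrite mul0r.
  apply: le_trans h _; apply: ler_wpM2l; last exact: sum_coord_le_edist.
  by rewrite divr_ge0 ?mulr_ge0// ltW.
have lowB2 y : eball B2 y -> 2^-1 * N <= B.2 ^+ size w * `|pd w f y|.
  move=> B2y; have := lip B2 w B2.1 y wD B2B B2c B2y.
  rewrite -(ler_pM2l (rhoX (size w))) => h.
  have {h} : B.2 ^+ size w * `|pd w f B2.1 - pd w f y| <= 2^-1 * N.
    apply: le_trans h _.
    have -> : 2^-1 * N = B.2 ^+ size w * (K * N / B.2 ^+ (size w).+1 *
        (k%:R * (s * B.2))).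
      by rewrite /s exprS; field; rewrite !gt_eqF.
    apply: ler_wpM2l; first exact: ltW.
    apply: ler_wpM2l; first by rewrite divr_ge0 ?mulr_ge0// ltW.
    by apply: ler_wpM2l => //; exact: le_trans B2y B2s.
  have := ler_normD (pd w f B2.1 - pd w f y) (pd w f y); rewrite subrK.
  rewrite -(ler_pM2l (rhoX (size w))) -NE mulrDr.
  by move=> h1 h2; lra.
apply: force_mono (chain _ _ U f B2 w B0 N0 fD _ _ wD tB2 lowB2) => [B3 [B32 tB3 fB3]||].
- have bt' : beta' * B.2 <= t' * B.2 by rewrite ler_pM2r// ge_min lexx.
  split; last exact: le_trans bt' tB3.
  move=> y B3y; have By := B2B _ (B32 _ B3y); split=> // -[z [Bz fz] yz].
  have := lip B [::] y z isT (@subset_refl _ _) By Bz; rewrite /= fz subr0 expr1.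
  apply/negP; rewrite -ltNge; apply: lt_le_trans (fB3 _ B3y).
  have -> : c' * N = K * N / B.2 * (k%:R * (c' / (k%:R * K) * B.2)).
    by field; rewrite !gt_eqF.
  rewrite ltr_pM2l ?divr_gt0 ?mulr_gt0// ltr_pM2l//.
  by apply: lt_le_trans yz _; rewrite ler_pM2r// ge_min lexx orbT.
- by move=> y /B2B/BU.
- by move=> v y vD /B2B; exact: Kub.
Qed.

(** * Simulating one game inside another *)

Section Plans.
Variables (R : realType) (k : nat) (beta : R).
Notation ball := ('rV[R]_k * R)%type.

(* A forcing strategy as data; it is well-founded, so a play that follows it
   reaches [Stop]. *)
Inductive plan := Stop | Play of set 'rV[R]_k & (ball -> plan).

Fixpoint achieves (P : ball -> Prop) (p : plan) (B : ball) : Prop :=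
  match p with
  | Stop => P B
  | Play A next => affine_hyperplane A /\
      forall B', bob_legal beta B A B' -> achieves P (next B') B'
  end.

(** Turns a proof of [force] into data from which a strategy can be computed; choice picks the
    continuations, with [Stop] after illegal replies. *)
Lemma force_plan P B : force beta P B -> exists p, achieves P p B.
Proof.
elim=> [{}B PB|{}B A hA _ IH]; first by exists Stop.
have /choice[next Hnext] : forall B', exists p,
    bob_legal beta B A B' -> achieves P p B'.
  move=> B'; have [/IH[p Hp]|nl] := pselect (bob_legal beta B A B').
    by exists p.
  by exists Stop => /nl.
by exists (Play A next).
Qed.

End Plans.

(** * Running the levelset strategy on a subsequence of Bob's balls *)

Section Transfer.
Variables (R : realType) (k : nat) (beta beta' rho' : R).
Hypotheses (k0 : (0 < k)%N) (beta0 : 0 < beta) (beta'0 : 0 < beta').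
Hypothesis rho'0 : 0 < rho'.
Notation ball := ('rV[R]_k * R)%type.
Variable legal : ball -> set 'rV[R]_k -> Prop.
Hypothesis forces : forall B A, 0 < B.2 -> B.2 <= rho' -> legal B A ->
  exists2 H, affine_hyperplane H & forall B', bob_legal beta B H B' ->
    force beta (bob_legal beta' B A) B'.
Variable S : set 'rV[R]_k.
Variable sigma : seq ball -> set 'rV[R]_k.
Hypothesis sigma_wins : forall b : nat -> ball,
  let A n := sigma (mkseq b n.+1) in
  0 < (b 0%N).2 ->
  (forall n, (forall m, (m < n)%N -> bob_legal beta' (b m) (A m) (b m.+1)) ->
     legal (b n) (A n)) /\
  ((forall n, bob_legal beta' (b n) (A n) (b n.+1)) ->
     (\bigcap_n eball (b n)) `&` S !=set0).

Let B0 : ball := (0, 0).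

(** The reachable histories of the simulated levelset game, with last radius small enough for
    [forces] to apply. *)
Let position (h : seq ball) := [/\ (0 < size h)%N, 0 < (nth B0 h 0).2,
  forall m, (m.+1 < size h)%N ->
    bob_legal beta' (nth B0 h m) (sigma (take m.+1 h)) (nth B0 h m.+1) &
  0 < (last B0 h).2 /\ (last B0 h).2 <= rho'].

Let target (h : seq ball) (B : ball) :=
  if h is [::] then 0 < B.2 /\ B.2 <= rho'
  else bob_legal beta' (last B0 h) (sigma h) B.

(** [sigma_wins] speaks of infinite sequences, so [h] is extended by the default ball; legality at
    the last position of [h] involves earlier moves only. *)
Let position_legal h : position h -> legal (last B0 h) (sigma h).
Proof.
move=> [h0 b0 hl _]; have [+ _] := sigma_wins b0.
have mk n : (n < size h)%N -> mkseq (nth B0 h) n.+1 = take n.+1 h.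
  move=> nh; apply: (@eq_from_nth _ B0).
    by rewrite size_mkseq size_takel.
  by move=> i; rewrite size_mkseq => ni; rewrite nth_mkseq// nth_take.
move=> /(_ (size h).-1); rewrite mk ?prednK// take_size nth_last; apply.
move=> m mh; have mh' : (m.+1 < size h)%N by rewrite -[ltnRHS]prednK.
by rewrite mk ?(ltnW mh')//; exact: hl.
Qed.

Let position_rcons h B : h = [::] \/ position h -> target h B ->
  position (rcons h B).
Proof.
move=> [->|]; first by case=> Bp Brho; split.
case: h => [[//]|B1 h]; set g := B1 :: h => -[szg g0 hg [l0 lrho]] tB.
have {}tB : bob_legal beta' (last B0 g) (sigma g) B := tB.
clearbody g.
have B20 : 0 < B.2 by case: tB => _; apply: lt_le_trans; rewrite mulr_gt0.
split; rewrite ?size_rcons ?last_rcons//.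
- by rewrite nth_rcons szg.
- move=> m; rewrite ltnS => mg; rewrite -cats1 takel_cat// !nth_cat mg.
  have [mg'|gm] := ltnP m.+1 (size g); first exact: hg.
  have Em : size g = m.+1 by apply/eqP; rewrite eqn_leq gm mg.
  rewrite Em subnn /= -Em take_size (_ : nth B0 g m = last B0 g) //.
  by rewrite -nth_last Em.
- split=> //; apply: le_trans lrho; apply: eball_sub_radius => //; first exact: ltW.
  by case: tB => + _ y By => /(_ y By)[].
Qed.

(** The state of the simulation consists of the simulated history, the hyperplane to play now and
    the continuation after Bob's reply. When a plan stops, Bob's ball joins the simulated history
    and the plan for the next round is loaded. Plans are well-founded, so an infinite play yields an
    infinite simulated one. *)
Lemma winning_transfer : winning beta (fun _ A => affine_hyperplane A) S.
Proof.
have /choice[load loadP] : forall h, exists q : set 'rV[R]_k * (ball -> plan R k),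
    position h -> affine_hyperplane q.1 /\ forall B',
      bob_legal beta (last B0 h) q.1 B' -> achieves beta (target h) (q.2 B') B'.
  move=> h; have [ph|nph] := pselect (position h); last first.
    by exists (set0, fun=> Stop R k) => /nph.
  have [h0 _ _ [l0 lrho]] := ph.
  have [H hH fH] := forces l0 lrho (position_legal ph).
  have /choice[next Hnext] : forall B', exists p,
      bob_legal beta (last B0 h) H B' -> achieves beta (target h) p B'.
    move=> B'; have [lB|nl] := pselect (bob_legal beta (last B0 h) H B').
      have [p Hp] := force_plan (fH _ lB); exists p => _.
      by rewrite /target; case: (h) h0 Hp.
    by exists (Stop R k) => /nl.
  by exists (H, next).
(* Before the first simulated ball, Alice only shrinks Bob's ball to radius at most [rho']. *)
have /choice[start startP] : forall B : ball, exists p, 0 < B.2 ->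
    achieves beta (target [::]) p B.
  move=> B; have [Bp|nB] := pselect (0 < B.2); last by exists (Stop R k) => /nB.
  have [p Hp] : exists p, achieves beta (target [::]) p B.
    apply: force_plan; apply: force_mono (force_shrink k0 beta0 rho'0 Bp).
    move=> B' [_ Brho lo]; split=> //.
    case: lo => [|/(lt_le_trans Bp)//]; apply: lt_le_trans.
    by rewrite mulr_gt0.
  by exists p.
pose enter (h : seq ball) (p : plan R k) (B : ball) :=
  match p with
  | Stop => (rcons h B, load (rcons h B))
  | Play A next => (h, (A, next))
  end.
pose update (s : seq ball * (set 'rV[R]_k * (ball -> plan R k))) (B : ball) :=
  enter s.1 (s.2.2 B) B.
pose init B := enter [::] (start B) B.
(* A strategy sees only the history, so the state is recomputed from it; histories are nonempty, and
   [head] returns Bob's first ball. *)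
pose tau (h : seq ball) := (foldl update (init (head B0 h)) (behead h)).2.1.
exists tau => b; pose st n := foldl update (init (b 0%N)) (map b (iota 1 n)).
have stS n : st n.+1 = enter (st n).1 ((st n).2.2 (b n.+1)) (b n.+1).
  have iotaS : iota 1 n.+1 = rcons (iota 1 n) n.+1.
    by rewrite -[in LHS](addn1 n) iotaD add1n cats1.
  by rewrite /st iotaS map_rcons foldl_rcons.
have tauE n : tau (mkseq b n.+1) = (st n).2.1 by [].
pose inv (s : seq ball * (set 'rV[R]_k * (ball -> plan R k))) B :=
  [/\ s.1 = [::] \/ position s.1, affine_hyperplane s.2.1 &
      forall B', bob_legal beta B s.2.1 B' -> achieves beta (target s.1) (s.2.2 B') B'].
have enter_inv h p B : h = [::] \/ position h -> achieves beta (target h) p B ->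
    inv (enter h p B) B.
  move=> hp; case: p => [/= tB|A next /= [hA nx]]; last by split.
  have pr := position_rcons hp tB; have [hyp nx] := loadP _ pr.
  by split; [right| |rewrite last_rcons in nx].
move=> A b0.
have inv_st n : (forall m, (m < n)%N -> bob_legal beta (b m) (A m) (b m.+1)) ->
    inv (st n) (b n).
  elim: n => [|n IH] leg; first by apply: enter_inv; [left | exact: startP].
  have [|pos _ nx] := IH; first by move=> m mn; apply: leg; exact: ltnW.
  by rewrite stS; apply: enter_inv => //; apply: nx; exact: leg.
split=> [n leg|leg]; first by have [_ + _] := inv_st n leg.
have {}inv_st n : inv (st n) (b n) by apply: inv_st.
(* Structural induction on the plan: every plan in progress reaches [Stop] and records a ball. *)
have stop p h n : st n = enter h p (b n) ->
    exists2 m, (n <= m)%N & (st m).1 = rcons h (b m).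
  elim: p n => [|H next IH] n stn; first by exists n; rewrite ?stn.
  have [|m nm Em] := IH (b n.+1) n.+1; first by rewrite stS stn.
  by exists m => //; exact: ltnW.
have /choice[next nextP] : forall n,
    exists m, (n < m)%N /\ (st m).1 = rcons (st n).1 (b m).
  by move=> n; have [m nm Em] := stop _ _ _ (stS n); exists m.
have [n0 _ En0] := stop (start (b 0%N)) [::] 0%N erefl.
pose idx i := iter i next n0; pose b' i := b (idx i).
have stE i : (st (idx i)).1 = mkseq b' i.+1.
  elim: i => [|i IH]; first by rewrite En0.
  by rewrite /= (nextP _).2 -/(idx i) IH [RHS]mkseqS.
have pos i : position (mkseq b' i.+1).
  by have [+ _ _] := inv_st (idx i); rewrite stE => -[].
have b'0 : 0 < (b' 0%N).2 by have [_ + _ _] := pos 0%N.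
have [_ /(_ _)[]] := sigma_wins b'0.
  move=> n; have [_ _ + _] := pos n.+1; move=> /(_ n).
  rewrite size_mkseq => /(_ (ltnSn _)); rewrite !nth_mkseq//.
  by rewrite mkseqS -cats1 take_size_cat ?size_mkseq.
move=> x [xb' xS]; exists x; split=> // n _.
have nested i j : (i <= j)%N -> eball (b j) `<=` eball (b i).
  move=> /subnK <-; elim: (j - i)%N => [//|d IH] y.
  by rewrite addSn => By; apply: IH; have [+ _] := leg (d + i)%N => /(_ y By)[].
(* The recorded indices increase strictly, so [n <= idx n]; by nesting, a point in all recorded
   balls lies in all of Bob's balls. *)
apply: (nested n (idx n)); last exact: xb'.
by elim: (n) => [//|i IH]; exact: leq_ltn_trans IH (nextP _).1.
Qed.

End Transfer.

Theorem theorem4p6 (R : realType) (k : nat) (hk : (1 <= k)%N)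
    (S : set 'rV[R]_k) :
  levelset_winning S -> hyperplane_winning S.
Proof.
move=> [D [C1 [C10 win]]] beta beta0.
(* [D] and [C1] are common to all parameters of the levelset game, so [beta'] may be computed from
   them before the strategy is requested. *)
have [beta' [rho' [beta'0 rho'0 step]]] := levelset_step D hk beta0 C10.
have [sigma sigma_wins] := win beta' beta'0.
exact: (winning_transfer hk beta0 beta'0 rho'0 step sigma_wins).
Qed.
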